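(* Let $(G,T)$ be a bipartite graft, and let $\tilde F$ be the set of allowed edges of $(G,T)$. Let $r\in V(G)$ and let $K$ be a decapital distance component of $(G,T)$ with respect to $r$. Let $U$ be the set of ends of the edges in $\tilde F\cap\partial_G(K)$. Then there exist a factor-component $C$ of $(G,T)$ and two distinct equivalence classes $S_1,S_2\in\mathcal{P}_C$ such that $U\cap V(K)\subseteq S_1$ and $U\setminus V(K)\subseteq S_2$.
   Context: All graphs are finite. For a graph $G$ and $X\subseteq V(G)$, $\partial_G(X)$ is the set of edges with exactly one end in $X$; for a subgraph $H$, $\partial_G(H):=\partial_G(V(H))$. A graft is a pair $(G,T)$ with $T\subseteq V(G)$ such that every connected component of $G$ contains an even number of vertices of $T$; it is bipartite if $G$ is bipartite. A join is a set $F\subseteq E(G)$ such that every vertex in $T$ is incident with an odd number of edges of $F$ and every other vertex with an even number; $\nu(G,T)$ is the minimum size of a join, and a minimum join is a join of that size. For $F\subseteq E(G)$, $w_F(e)=-1$ if $e\in F$ and $+1$ otherwise, extended additively to paths; for a minimum join $F$, $d_F(x,y)$ is the minimum $F$-weight of a path between $x$ and $y$ (independent of $F$). For a root $r$ and integer $i$, $L_{\le i}(r)=\{x:d_F(r,x)\le i\}$; the distance components with respect to $r$ are the connected components of $G[L_{\le i}(r)]$ for $i\in\{d_F(r,x):x\in V(G)\}$; those not containing $r$ are decapital. An edge is allowed if it belongs to some minimum join. Two vertices are factor-connected if $G$ has a path between them all of whose edges are allowed; a factor-component is a maximal subgraph of $G$ in which every two vertices are factor-connected. For $u,v\in V(G)$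 write $u\sim v$ if $u=v$, or $u,v$ are distinct vertices of the same factor-component with $\nu(G,T)=\nu(G,T\Delta\{u,v\})$. It is known that $\sim$ is an equivalence relation on $V(G)$ each of whose classes is contained in a factor-component; for a factor-component $C$, $\mathcal{P}_C$ denotes the set of equivalence classes contained in $V(C)$. *)

(* Defs.v *)
From HB Require Import structures.
From mathcomp Require Import all_boot all_order all_algebra.
From mathcomp Require Import boolp.

Set Implicit Arguments.
Unset Strict Implicit.
Unset Printing Implicit Defensive.

Import Order.TTheory GRing.Theory Num.Theory.

(* Finite graphs with vertex type V and edge type E; parallel edges are
   allowed.  Loops are not, which is harmless since only bipartite graphs are
   considered, and makes the parity condition for joins unambiguous. *)
Record graph (V E : finType) := Graph {
  ends : E -> {set V};
  card_ends : forall e, #|ends e| = 2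
}.

Section Graphs.
Variables (V E : finType) (G : graph V E).
Implicit Types (x y : V) (X L K C : {set V}) (F : {set E}).

Definition bipartite : Prop :=
  exists A : {set V}, forall e, #|ends G e :&: A| = 1.

Definition boundary X : {set E} := [set e | #|ends G e :&: X| == 1].

Definition adj_in X : rel V :=
  [rel x y | [&& x \in X, y \in X & [exists e, ends G e == [set x; y]]]].

(* The vertex sets of the connected components of the induced subgraph G[X]. *)
Definition components X : {set {set V}} :=
  equivalence_partition (connect (adj_in X)) X.

(* A path from x is given by the sequence of its steps: the edge traversed,
   together with the vertex reached. *)
Fixpoint walk x (p : seq (E * V)) : bool :=
  if p is (e, v) :: p' then (ends G e == [set x; v]) && walk v p' else true.

Definition path_between x y (p : seq (E * V)) : bool :=
  [&& walk x p, uniq (x :: unzip2 p) & last x (unzip2 p) == y].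

Definition weight F (e : E) : int := if e \in F then (-1)%R else 1%R.

Definition path_weight F (p : seq (E * V)) : int :=
  (\sum_(s <- p) weight F s.1)%R.

(* dist_is F x y d states that d_F(x, y) is defined and equal to d; when no
   path joins x and y, it holds for no d. *)
Definition dist_is F x y (d : int) : Prop :=
  (exists2 p, path_between x y p & path_weight F p = d) /\
  (forall p, path_between x y p -> (d <= path_weight F p)%R).

Definition sublevel F r (i : int) : {set V} :=
  [set x | `[< exists2 d, dist_is F r x d & (d <= i)%R >]].

Definition distance_component F r K : Prop :=
  exists2 i : int, (exists x, dist_is F r x i) &
    K \in components (sublevel F r i).

Definition decapital_distance_component F r K : Prop :=
  distance_component F r K /\ r \notin K.

Section Grafts.
Variable T : {set V}.

Definition graft : Prop :=
  forall K, K \in components [set: V] -> ~~ odd #|K :&: T|.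

Definition is_join F : bool :=
  [forall x, odd #|[set e in F | x \in ends G e]| == (x \in T)].

(* The default value #|E| bounds the size of every join, so it only matters
   when there is no join at all. *)
Definition nu : nat := \big[minn/#|E|]_(F : {set E} | is_join F) #|F|.

Definition min_join F : bool := is_join F && (#|F| == nu).

Definition allowed : {set E} := [set e | [exists F, min_join F && (e \in F)]].

Definition factor_connected : rel V :=
  connect [rel x y | [exists e in allowed, ends G e == [set x; y]]].

(* Maximal subgraphs with pairwise factor-connected vertices are induced, hence
   determined by their vertex sets. *)
Definition factor_component C : bool :=
  maxset (fun X : {set V} =>
    [forall x in X, forall y in X, factor_connected x y]) C.

End Grafts.

Definition symdiff X Y : {set V} := (X :\: Y) :|: (Y :\: X).

Definition sim (T : {set V}) : rel V :=
  [rel u v | (u == v) ||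
    [exists C, [&& factor_component T C, u \in C & v \in C]] &&
    (nu T == nu (symdiff T [set u; v]))].

Definition classes_in (T : {set V}) C : {set {set V}} :=
  [set S in equivalence_partition (sim T) [set: V] | S \subset C].

End Graphs.

(* Main.v *)
Require Import Defs.
From mathcomp Require Import all_boot all_order all_algebra.
From mathcomp Require Import boolp zify.

Set Implicit Arguments.
Unset Strict Implicit.
Unset Printing Implicit Defensive.

(* Write d for the distance and l(x) = d(r, x), so that d(x, y) is the excess of
   the minimum size of a join for T + {x, y} over nu(G, T). Joins satisfy an
   exchange property: if the odd sets of M1 and M2 differ in a, b, c, d, then a
   path of the symmetric difference can be swapped, which moves a together with
   one of b, c, d from one odd set to the other and keeps |M1| + |M2|.
   Exchanging along a path of G[l <= i] gives d(z, z') >= l(z) + l(z') - 2 i for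
   z, z' in one component, and a four-vertex analogue. It follows that a minimum
   join meets the boundary of a decapital component K in exactly one edge, and
   that d(u, u') and d(v, v') are nonnegative for the inner ends u, u' and the
   outer ends v, v' of boundary edges. Given two minimum joins with boundary
   edges uv and u'v', swapping them inside K gives two joins for T + {u, u'} of
   total size 2 nu(G, T), hence u ~ u', and swapping them outside K gives v ~ v'.
   Counting edges across C and K together, for the factor-component C of u, puts
   u' into C. Finally u ~ v fails because deleting uv shrinks the join. *)

(** * Odd-degree vertices of edge sets, cuts and paths *)

Section OddSets.
Variables (V E : finType) (G : graph V E).
Implicit Types (x y a b : V) (X K : {set V}) (M N Q : {set E}) (s : seq V).

Definition sdiff (M N : {set E}) : {set E} := (M :\: N) :|: (N :\: M).

Lemma in_sdiff M N e : (e \in sdiff M N) = (e \in M) (+) (e \in N).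
Proof. by rewrite !inE; case: (e \in M); case: (e \in N). Qed.

Definition odd_at M x : bool := odd #|[set e in M | x \in ends G e]|.

Lemma odd_card (I : finType) (A : {set I}) :
  odd #|A| = \big[addb/false]_(i : I) (i \in A).
Proof.
rewrite -sum1_card big_mkcond (big_morph odd oddD (erefl : odd 0 = false)).
by apply: eq_bigr => i _; case: ifP.
Qed.

Lemma odd_at_big M x :
  odd_at M x = \big[addb/false]_e ((e \in M) && (x \in ends G e)).
Proof. by rewrite /odd_at odd_card; apply: eq_bigr => e _; rewrite inE. Qed.

Lemma odd_at_sdiff M N x : odd_at (sdiff M N) x = odd_at M x (+) odd_at N x.
Proof.
rewrite !odd_at_big -big_split; apply: eq_bigr => e _ /=.
by rewrite in_sdiff; case: (e \in M); case: (e \in N); case: (x \in _).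
Qed.

Lemma odd_at1 e x : odd_at [set e] x = (x \in ends G e).
Proof.
rewrite odd_at_big (bigD1 e) //= inE eqxx big1 ?addbF // => f /negPf nf.
by rewrite inE nf.
Qed.

Lemma odd_at_set0 x : odd_at set0 x = false.
Proof. by rewrite odd_at_big big1 // => e _; rewrite inE. Qed.

Lemma odd_card_endsI e X : odd #|ends G e :&: X| = (#|ends G e :&: X| == 1).
Proof.
have := subset_leq_card (subsetIl (ends G e) X); rewrite card_ends.
by case: #|_| => [|[|[]]].
Qed.

(** Double counting: the right-hand side counts an edge of [M] once for each of its ends in [X],
    which is odd exactly on the boundary. *)
Lemma cut_parity M X :
  odd #|M :&: boundary G X| = \big[addb/false]_(x in X) odd_at M x.
Proof.
under eq_bigr do rewrite odd_at_big.
rewrite exchange_big odd_card; apply: eq_bigr => e _ /=.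
rewrite !inE -odd_card_endsI odd_card big_mkcond /=.
case: (e \in M) => /=; last by rewrite big1 // => i _; rewrite if_same.
rewrite [RHS]big_mkcond /=; apply: eq_bigr => x _.
by rewrite inE; case: (x \in X); rewrite ?andbT ?andbF.
Qed.

Lemma ends_neq e x y : ends G e = [set x; y] -> x != y.
Proof.
by move=> h; have := card_ends G e; rewrite h cards2; case: (x != y).
Qed.

Lemma in_ends_xor e x y v :
  ends G e = [set x; y] -> (v \in ends G e) = (v == x) (+) (v == y).
Proof.
move=> h; have := ends_neq h; rewrite h !inE.
by case: (eqVneq v x) => [->|_] //= /negPf ->.
Qed.

Lemma in_boundary e x y X : ends G e = [set x; y] ->
  (e \in boundary G X) = (x \in X) (+) (y \in X).
Proof.
move=> h; have nxy := ends_neq h; rewrite inE h.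
have -> : [set x; y] :&: X = (if x \in X then [set x] else set0) :|:
                            (if y \in X then [set y] else set0).
  apply/setP=> z; rewrite !inE andb_orl.
  have memif v : (z \in if v \in X then [set v] else set0) = (z == v) && (z \in X).
    by case: ifP => vX; rewrite !inE; case: eqP => // ->; rewrite vX.
  by rewrite !memif.
by case: (x \in X); case: (y \in X);
  rewrite ?setU0 ?set0U ?cards2 ?cards1 ?cards0 ?nxy.
Qed.

(** Odd sets are encoded as lists counted modulo 2: repeated vertices cancel, so a statement about
    such a list also covers coinciding vertices. *)
Definition parity s x : bool := foldr (fun v (c : bool) => (x == v) (+) c) false s.

Definition step_edges (p : seq (E * V)) : {set E} := [set e in unzip1 p].

Lemma walk_ends_sub x p e :
  walk G x p -> e \in unzip1 p -> {subset ends G e <= x :: unzip2 p}.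
Proof.
elim: p x => [|[f v] p IH] x //= /andP[/eqP hf hw].
rewrite inE => /predU1P[->|he] z.
  by rewrite hf !inE => /orP[] ->; rewrite ?orbT.
by move=> hz; rewrite inE (IH v hw he z hz) orbT.
Qed.

Lemma path_edges_uniq x p :
  walk G x p -> uniq (x :: unzip2 p) -> uniq (unzip1 p).
Proof.
elim: p x => [|[f v] p IH] x //= /andP[/eqP hf hw] /andP[hx hu].
rewrite (IH v) // andbT; apply: contra hx => hfp.
by apply: (walk_ends_sub hw hfp); rewrite hf !inE eqxx.
Qed.

Lemma odd_at_path x y p :
  path_between G x y p -> odd_at (step_edges p) =1 parity [:: x; y].
Proof.
rewrite /path_between; elim: p x => [|[f v] p IH] x /and3P[hw hu hl] z.
  move/eqP: hl => /= <-; rewrite /step_edges /= addbF addbb.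
  by rewrite (_ : [set e in [::]] = set0) ?odd_at_set0 //; apply/setP=> e; rewrite !inE.
have hu1 := path_edges_uniq hw hu.
have -> : step_edges ((f, v) :: p) = sdiff [set f] (step_edges p).
  apply/setP=> e; rewrite in_sdiff !inE /=.
  by move: hu1 => /= /andP[/negPf nf _]; case: eqP => // ->; rewrite nf.
move: hw hu hl => /= /andP[/eqP hf hw] /andP[_ hu] hl.
rewrite odd_at_sdiff odd_at1 (in_ends_xor _ hf) (IH v) /=; last exact/and3P.
by case: (z == x); case: (z == v); case: (z == y).
Qed.

(** Toggling an edge of [Q] removes it if it lies in [M] and adds it otherwise, which is what
    [weight M] records. *)
Lemma card_sdiff_weight M Q :
  (#|sdiff M Q|%:Z = #|M|%:Z + \sum_(e in Q) weight M e)%R.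
Proof.
rewrite -[#|M|]sum1_card -[#|sdiff M Q|]sum1_card.
rewrite !(big_mkcond (fun i => i \in _)) /=.
rewrite -[X in X = _]natz -[X in _ = (X + _)%R]natz !GRing.natr_sum -big_split /=.
apply: eq_bigr => e _; rewrite in_sdiff /weight.
by case: (e \in M); case: (e \in Q).
Qed.

Lemma path_weight_card M x y p : path_between G x y p ->
  (#|sdiff M (step_edges p)|%:Z = #|M|%:Z + path_weight M p)%R.
Proof.
move=> /and3P[hw hu _]; rewrite card_sdiff_weight; congr (_ + _)%R.
rewrite /path_weight -(big_map fst xpredT (weight M)) big_uniq /=.
  by apply: eq_bigl => e; rewrite inE.
exact: path_edges_uniq hw hu.
Qed.

(** Each edge of [Q] lies in exactly one of [M] and [N], and the swap moves it to the other. *)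
Lemma card_sdiff_exchange M N Q : Q \subset sdiff M N ->
  #|sdiff M Q| + #|sdiff N Q| = #|M| + #|N|.
Proof.
move=> /subsetP sQ.
rewrite -[#|M|]sum1_card -[#|N|]sum1_card.
rewrite -[#|sdiff M Q|]sum1_card -[#|sdiff N Q|]sum1_card.
rewrite !(big_mkcond (fun i => i \in _)) /= -!big_split /=.
apply: eq_bigr => e _; have := sQ e; rewrite !in_sdiff.
by case: (e \in M); case: (e \in N); case: (e \in Q) => // /(_ isT).
Qed.

Definition edge_rel M : rel V :=
  [rel x y | [exists e in M, ends G e == [set x; y]]].

Lemma edge_rel_sym M : symmetric (edge_rel M).
Proof. by move=> x y /=; apply: eq_existsb => e; rewrite setUC. Qed.

Lemma walk_of_path M x q : path (edge_rel M) x q ->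
  exists p, [/\ walk G x p, unzip2 p = q & {subset unzip1 p <= M}].
Proof.
elim: q x => [|v q IH] x /=; first by exists [::].
case/andP => /exists_inP[e eM hev] /IH[p [hw <- hs]].
exists ((e, v) :: p); split => //=; first by rewrite hev.
by move=> f; rewrite inE => /predU1P[->|/hs].
Qed.

(** The vertices reachable from [a] along [M] have no edge of [M] on their boundary, so by
    [cut_parity] an even number of them are odd, hence one besides [a]. *)
Lemma odd_path M a : odd_at M a ->
  exists y p, [/\ y != a, odd_at M y, path_between G a y p &
                  step_edges p \subset M].
Proof.
move=> ha; pose X := [set y | connect (edge_rel M) a y].
have aX : a \in X by rewrite inE connect0.
have h0 : M :&: boundary G X = set0.
  apply/setP=> e; rewrite inE [RHS]inE; apply/negP => /andP[eM].
  have /eqP/cards2P[x [y [_ hxy]]] := card_ends G e.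
  have exy : edge_rel M x y by apply/exists_inP; exists e => //; rewrite hxy.
  have eyx : edge_rel M y x by rewrite edge_rel_sym.
  rewrite (in_boundary _ hxy) !inE; case hx: (connect _ a x).
    by rewrite (connect_trans hx (connect1 exy)).
  case hy: (connect _ a y) => //.
  by rewrite (connect_trans hy (connect1 eyx)) in hx.
have := cut_parity M X; rewrite h0 cards0 /= (bigD1 a) //= ha.
case: (pickP [pred y | [&& y \in X, y != a & odd_at M y]]) => [y /and3P[yX ya oy] _|no].
  move: yX ya oy; rewrite inE => /connectP[q hq ->].
  case/shortenP: hq => q' hq' uq' _ ya oy.
  have [p [hw hp hs]] := walk_of_path hq'.
  exists (last a q'), p; split=> //.
    by rewrite /path_between hw hp uq' eqxx.
  by apply/subsetP => e; rewrite inE; apply: hs.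
rewrite big1 // => y /andP[yX ya].
by have := no y; rewrite /= yX ya.
Qed.
End OddSets.

(** * Joins for shifted odd sets and the distance from the root *)

Section Levels.
Variables (V E : finType) (G : graph V E) (T : {set V}) (r : V).
Implicit Types (x y z q : V) (X L K : {set V}) (M N F : {set E}) (s : seq V).

Lemma bigminn_le (I : eqType) (t : seq I) (P : pred I) (f : I -> nat) k i :
  i \in t -> P i -> \big[minn/k]_(j <- t | P j) f j <= f i.
Proof.
elim: t => // j t IH; rewrite inE big_cons => /predU1P[<- ->|it Pi].
  exact: geq_minl.
by case: ifP => _; rewrite ?geq_min IH ?orbT.
Qed.

Lemma nu_le X M : is_join G X M -> nu G X <= #|M|.
Proof. by move=> hM; apply: bigminn_le hM; rewrite mem_index_enum. Qed.

Lemma nu_eq X M : is_join G X M ->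
  (forall N, is_join G X N -> #|M| <= #|N|) -> nu G X = #|M|.
Proof.
move=> hM hmin; apply/eqP; rewrite eqn_leq nu_le //=.
apply: (big_ind (fun k => #|M| <= k)) => [|k l hk hl|N /hmin //].
  (* The default value [#|E|] of the minimum. *)
  exact: max_card.
by rewrite leq_min hk.
Qed.

(** For [s = [:: x; y]] with [x != y], these are the joins of the graft with [T] replaced by T Δ {x,
    y}. *)
Definition join_shift s M : Prop :=
  forall x, odd_at G M x = (x \in T) (+) parity s x.

Lemma is_join_shift M : is_join G T M <-> join_shift [::] M.
Proof.
split=> [/forallP h x|h]; first by rewrite addbF; apply/eqP/h.
by apply/forallP => x; apply/eqP; have := h x; rewrite addbF.
Qed.

(** For [s = [:: x; y]] this bounds the distance of [x] and [y] from below; the exchange arguments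
    also need four vertices. It holds vacuously when there is no such join. *)
Definition shift_ge s (c : int) : Prop :=
  forall M, join_shift s M -> ((nu G T)%:Z + c <= #|M|%:Z)%R.

(* By [lev_dist] below, this is d_F(r, x) = d for every minimum join F. *)
Definition lev x (d : int) : Prop :=
  (exists2 M, join_shift [:: r; x] M & (#|M|%:Z = (nu G T)%:Z + d)%R) /\
  shift_ge [:: r; x] d.

Ltac xor := rewrite /= ?addbF; do ?[case: (_ == _)]; by case: (_ \in T).

Lemma eq_shift_ge s s' c :
  parity s =1 parity s' -> shift_ge s c -> shift_ge s' c.
Proof. by move=> h hs M hM; apply: hs => x; rewrite hM h. Qed.

Lemma shift_ge0 : shift_ge [::] 0.
Proof. by move=> M /is_join_shift/nu_le; lia. Qed.

(** Toggling [e] turns a join for the longer list into one for [s], with at most one edge more. *)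
Lemma shift_ge_edge e x y s c : ends G e = [set x; y] ->
  shift_ge s c -> shift_ge [:: x, y & s] (c - 1).
Proof.
move=> he hs M hM.
have /hs : join_shift s (sdiff M [set e]).
  move=> v; rewrite odd_at_sdiff odd_at1 hM (in_ends_xor _ he) /=.
  by do ?[case: (_ == _)]; case: (_ \in T); case: (parity s v).
have : #|sdiff M [set e]| <= #|M| + 1.
  rewrite (leq_trans (leq_card_setU _ _)) // leq_add ?subset_leq_card ?subsetDl //.
  by rewrite -(cards1 e) subset_leq_card ?subsetDl.
lia.
Qed.

(* The exchange axiom of valuated delta-matroids: split off a path starting at
   [a] from the symmetric difference and swap the two joins along it. *)
Lemma exchange s1 s2 a b c d M1 M2 :
  join_shift s1 M1 -> join_shift s2 M2 ->
  (forall x, parity s1 x (+) parity s2 x = parity [:: a; b; c; d] x) ->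
  exists y N1 N2, [/\ y \in [:: b; c; d], join_shift [:: a, y & s1] N1,
    join_shift [:: a, y & s2] N2 & #|N1| + #|N2| = #|M1| + #|M2|].
Proof.
move=> h1 h2 h12.
(* If [a] recurs, then [y = a] works without any swap, because the pair cancels. *)
case ain: (a \in [:: b; c; d]).
  by exists a, M1, M2; split=> // x; rewrite ?h1 ?h2 /=; case: (x == a);
    rewrite //= negbK.
have oD x : odd_at G (sdiff M1 M2) x = parity [:: a; b; c; d] x.
  rewrite odd_at_sdiff h1 h2 -h12.
  by case: (_ \in T); case: (parity s1 x); case: (parity s2 x).
have /odd_path[y [p [ya oy hp sp]]] : odd_at G (sdiff M1 M2) a.
  move: ain; rewrite oD !inE /= eqxx addbF.
  by case: (a == b); case: (a == c); case: (a == d).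
exists y, (sdiff M1 (step_edges p)), (sdiff M2 (step_edges p)).
split; last exact: card_sdiff_exchange.
- move: oy; rewrite oD !inE /= (negPf ya) addbF /=.
  by case: (y == b); case: (y == c); case: (y == d).
- move=> x; rewrite odd_at_sdiff h1 (odd_at_path hp) /= addbF.
  by do ?[case: (_ == _)]; case: (_ \in T); case: (parity s1 x).
- move=> x; rewrite odd_at_sdiff h2 (odd_at_path hp) /= addbF.
  by do ?[case: (_ == _)]; case: (_ \in T); case: (parity s2 x).
Qed.

Lemma lev_uniq x d d' : lev x d -> lev x d' -> d = d'.
Proof.
move=> [[M hM eM] lM] [[N hN eN] lN].
by have := lM _ hN; have := lN _ hM; lia.
Qed.

Lemma lev_exists x M : join_shift [:: r; x] M -> exists d, lev x d.
Proof.
pose P n := `[< exists2 N, join_shift [:: r; x] N & #|N| = n >].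
move=> hM; have exP : exists n, P n by exists #|M|; apply/asboolP; exists M.
case: (ex_minnP exP) => n /asboolP[N hN eN] hmin.
exists (n%:Z - (nu G T)%:Z)%R; split; first by exists N => //; lia.
move=> M' hM'; have : P #|M'| by apply/asboolP; exists M'.
by move/hmin; lia.
Qed.

Lemma min_join_path F x y p : min_join G T F -> path_between G x y p ->
  join_shift [:: x; y] (sdiff F (step_edges p)) /\
  (#|sdiff F (step_edges p)|%:Z = (nu G T)%:Z + path_weight F p)%R.
Proof.
case/andP=> /is_join_shift hF /eqP eF hp; split.
  by move=> v; rewrite odd_at_sdiff hF (odd_at_path hp) addbF.
by rewrite (path_weight_card _ hp) eF.
Qed.

(** The symmetric difference of [F] and a smallest join [M] for [[:: r; x]] contains a path from [r]
    to [x]. Swapping along it turns [M] into a join for [T], of size at least [nu], so the path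
    weighs at most [d]; [shift_ge] gives the converse. *)
Lemma lev_path F x d : min_join G T F -> lev x d ->
  exists2 p, path_between G r x p & path_weight F p = d.
Proof.
move=> mF [[M hM eM] lM]; have /andP[/is_join_shift hF /eqP eF] := mF.
case: (eqVneq x r) => [xr|xr].
  subst x.
  exists [::]; first by rewrite /path_between /= eqxx.
  rewrite /path_weight big_nil.
  have /lM : join_shift [:: r; r] F by move=> v; rewrite hF; xor.
  have /shift_ge0 : join_shift [::] M by move=> v; rewrite hM; xor.
  lia.
have oD v : odd_at G (sdiff M F) v = parity [:: r; x] v.
  by rewrite odd_at_sdiff hM hF; xor.
have /odd_path[y [p [yr oy hp sp]]] : odd_at G (sdiff M F) r.
  by rewrite oD /= eqxx eq_sym (negPf xr).
have eyx : y = x.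
  by move: oy; rewrite oD /= (negPf yr) addbF => /eqP.
rewrite {}eyx in hp; exists p => //.
have [h1 e1] := min_join_path mF hp.
have /shift_ge0 : join_shift [::] (sdiff M (step_edges p)).
  by move=> v; rewrite odd_at_sdiff hM (odd_at_path hp); xor.
have := lM _ h1; have := card_sdiff_exchange sp; lia.
Qed.

Lemma lev_dist F x d : min_join G T F -> dist_is G F r x d <-> lev x d.
Proof.
move=> mF.
have aux e : lev x e -> dist_is G F r x e.
  move=> hl; split; first exact: lev_path.
  by case: hl => _ hl p /(min_join_path mF)[/hl]; lia.
split; last exact: aux.
move=> [[p hp ep] hd].
have [/lev_exists[e he] _] := min_join_path mF hp.
case: (aux _ he) => [[p' hp' ep'] hd'].
suff <- : e = d by [].
by have := hd _ hp'; have := hd' _ hp; lia.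
Qed.

(** No join occurs here, so all minimum joins share the same sublevel sets and the same
    components. *)
Definition levels_le (i : int) : {set V} :=
  [set x | `[< exists2 d, lev x d & (d <= i)%R >]].

Lemma sublevelE F i : min_join G T F -> sublevel G F r i = levels_le i.
Proof.
move=> mF; apply/setP=> x; rewrite !inE; apply: asbool_equiv_eq.
by split=> -[d /(lev_dist _ _ mF) hd hi]; exists d.
Qed.

(** * Levels in a bipartite graft *)

Hypothesis hbip : bipartite G.

(** Every edge crosses the bipartition, so the whole join is a cut, and [cut_parity] expresses its
    size modulo 2 through the odd set alone. *)
Lemma eq_card_parity s M N :
  join_shift s M -> join_shift s N -> odd #|M| = odd #|N|.
Proof.
have [A hA] := hbip => hM hN.
have bA : boundary G A = setT by apply/setP=> e; rewrite !inE hA.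
rewrite -[M]setIT -[N]setIT -bA !cut_parity.
by apply: eq_bigr => x _; rewrite hM hN.
Qed.

(** Toggling [e] changes the size of a join by exactly one, so the levels differ by at most one;
    parity excludes equality. *)
Lemma lev_adj e x y a b : ends G e = [set x; y] -> lev x a -> lev y b ->
  b = (a + 1)%R \/ b = (a - 1)%R.
Proof.
move=> he [[M hM eM] lM] [[N hN eN] lN].
have hM' : join_shift [:: r; y] (sdiff M [set e]).
  by move=> v; rewrite odd_at_sdiff odd_at1 hM (in_ends_xor _ he); xor.
have hN' : join_shift [:: r; x] (sdiff N [set e]).
  by move=> v; rewrite odd_at_sdiff odd_at1 hN (in_ends_xor _ he); xor.
have := eq_card_parity hM' hN; have := lN _ hM'; have := lM _ hN'.
have := card_sdiff_weight M [set e]; have := card_sdiff_weight N [set e].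
by rewrite !big_set1 /weight; case: ifP => _; case: ifP => _; lia.
Qed.

(* Induction along a path of the sublevel graph. Where the level rises, exchange
   with a smallest join realising the level of the previous vertex; the slack
   [b <= i] absorbs the two pairings that do not come from the induction.
   Taking [q = r] bounds d_F(z, z') itself. *)
Lemma component_shift_ge i z z' a b q c :
  z \in levels_le i -> connect (adj_in G (levels_le i)) z z' ->
  lev z a -> lev z' b -> shift_ge [:: r; q] c ->
  shift_ge [:: r; q; z; z'] (c + a + b - i - i).
Proof.
have hL x : x \in levels_le i -> exists2 d, lev x d & (d <= i)%R.
  by rewrite inE => /asboolP.
move=> zL /connectP[p hp ->{z'}] la lb hq.
elim/last_ind: p b hp lb => [|p w IH] b /=.
  move=> _ lb; have eab := lev_uniq la lb; subst b.
  have [a' la' le_a'i] := hL _ zL; have eaa := lev_uniq la la'; subst a'.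
  move=> M hM; have /hq : join_shift [:: r; q] M by move=> v; rewrite hM; xor.
  lia.
rewrite rcons_path last_rcons => /andP[hp /and3P[yL wL /existsP[e /eqP he]]] lb.
have [d ld _] := hL _ yL; have {}IH := IH d hp ld.
move: (last z p) yL he ld IH => y yL he ld IH.
have [b' lb' le_bi] := hL _ wL; have ebb := lev_uniq lb lb'; subst b'.
have [eb|eb] := lev_adj he ld lb; last first.
  (* The level falls: the one lost by toggling [e] is the drop from [d] to [b]. *)
  apply: (eq_shift_ge (s := [:: y; w; r; q; z; y])); first by move=> v; xor.
  have := shift_ge_edge he IH; rewrite (_ : _ - 1 = c + a + b - i - i)%R //.
  by rewrite eb; lia.
move=> M hM; have [[M2 hM2 eM2] _] := ld.
have [_ lbw] := lb; have [_ laz] := la.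
have hx v : parity [:: r; q; z; w] v (+) parity [:: r; y] v =
            parity [:: w; y; q; z] v by xor.
have [k [N1 [N2 [kin hN1 hN2 eN]]]] := exchange hM hM2 hx.
move: kin; rewrite !inE => /or3P[] /eqP ek; subst k.
(* [w] is paired with [y]: the induction bound and the level [b] of [w], less the excess [d] of
   [M2], give the exact bound. *)
- have /IH : join_shift [:: r; q; z; y] N1 by move=> v; rewrite hN1; xor.
  have /lbw : join_shift [:: r; w] N2 by move=> v; rewrite hN2; xor.
  lia.
(* Here and in the next case the bound obtained is [c + a - 1 - d], which is [c + a - b]; it
   suffices since [b <= i]. *)
- have /laz : join_shift [:: r; z] N1 by move=> v; rewrite hN1; xor.
  have /(shift_ge_edge he hq) : join_shift [:: y; w; r; q] N2.
    by move=> v; rewrite hN2; xor.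
  lia.
- have /hq : join_shift [:: r; q] N1 by move=> v; rewrite hN1; xor.
  have /(shift_ge_edge he laz) : join_shift [:: y; w; r; z] N2.
    by move=> v; rewrite hN2; xor.
  lia.
Qed.

Lemma component_dist_ge i z z' a b :
  z \in levels_le i -> connect (adj_in G (levels_le i)) z z' ->
  lev z a -> lev z' b -> shift_ge [:: z; z'] (a + b - i - i).
Proof.
move=> zL hc la lb.
apply: (eq_shift_ge (s := [:: r; r; z; z'])); first by move=> v; xor.
rewrite -[a]GRing.add0r; apply: component_shift_ge zL hc la lb _.
by apply: eq_shift_ge shift_ge0 => v; xor.
Qed.

(** * The boundary of a component of a sublevel set *)

Section Component.
Variables (i : int) (K : {set V}).
Hypothesis hK : K \in components G (levels_le i).

Lemma adj_in_sym X : symmetric (adj_in G X).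
Proof.
move=> x y; rewrite /adj_in /= andbCA; congr [&& _, _ & _].
by apply: eq_existsb => e; rewrite setUC.
Qed.

Lemma component_mem x y : x \in K ->
  (y \in K) = (y \in levels_le i) && connect (adj_in G (levels_le i)) x y.
Proof.
move: hK => /imsetP[x0 _ ->]; rewrite [x \in _]inE [y \in _]inE => /andP[_ h].
by rewrite (same_connect (sym_connect_sym (@adj_in_sym _)) h).
Qed.

(** An outer end of level at most [i] would belong to [K]. So its level exceeds [i], while that of
    the inner end does not, and the two differ by one. *)
Lemma boundary_lev e : e \in boundary G K -> exists x y,
  [/\ ends G e = [set x; y], x \in K, y \notin K, lev x i & lev y (i + 1)].
Proof.
move=> eK.
have [x [y [he xK yK]]] : exists x y, [/\ ends G e = [set x; y], x \in K & y \notin K].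
  have /eqP/cards2P[x [y [_ he]]] := card_ends G e.
  move: eK; rewrite (in_boundary _ he).
  case xK: (x \in K); case yK: (y \in K) => // _; first by exists x, y; rewrite yK.
  by exists y, x; rewrite setUC xK.
exists x, y.
have := component_mem x xK; rewrite xK connect0 andbT => /esym xL.
have [d ld di] : exists2 d, lev x d & (d <= i)%R by move: xL; rewrite inE => /asboolP.
have [[M hM _] _] := ld.
have /lev_exists[d' ld'] : join_shift [:: r; y] (sdiff M [set e]).
  by move=> v; rewrite odd_at_sdiff odd_at1 hM (in_ends_xor _ he); xor.
have d'i : (i < d')%R.
  rewrite Order.TotalTheory.ltNge; apply: contra yK => d'i.
  have yL : y \in levels_le i by rewrite inE; apply/asboolP; exists d'.
  rewrite (component_mem _ xK) yL connect1 //=.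
  by rewrite /adj_in /= xL yL; apply/existsP; exists e; rewrite he.
have [ed|ed] := lev_adj he ld ld'; last by lia.
have edi : d = i by lia.
by subst d d'; split.
Qed.

Lemma component_in x : x \in K -> x \in levels_le i.
Proof. by move=> xK; have := component_mem x xK; rewrite xK => /esym/andP[]. Qed.

Lemma component_connect x y :
  x \in K -> y \in K -> connect (adj_in G (levels_le i)) x y.
Proof. by move=> xK; rewrite (component_mem _ xK) => /andP[]. Qed.

(** One level higher, the outer ends are joined to each other through [K], so the component bounds
    apply to them with [i + 1]. *)
Lemma outer_connect e f x y z w :
  ends G e = [set x; y] -> ends G f = [set z; w] -> x \in K -> z \in K ->
  lev y (i + 1) -> lev w (i + 1) ->
  let L := levels_le (i + 1) in
  [/\ y \in L, w \in L, x \in L, connect (adj_in G L) y w & connect (adj_in G L) x w].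
Proof.
move=> he hf xK zK ly lw L.
have sL : {subset levels_le i <= L}.
  move=> v; rewrite !inE => /asboolP[d ld di]; apply/asboolP; exists d => //; lia.
have inL v : lev v (i + 1) -> v \in L.
  by move=> lv; rewrite inE; apply/asboolP; exists (i + 1)%R.
have xL := sL _ (component_in xK); have zL := sL _ (component_in zK).
have sub : subrel (connect (adj_in G (levels_le i))) (connect (adj_in G L)).
  apply: connect_sub => u v /and3P[uL vL ex]; apply: connect1.
  by rewrite /adj_in /= !sL.
have czw : connect (adj_in G L) z w.
  by apply: connect1; rewrite /adj_in /= zL inL //=; apply/existsP; exists f; rewrite hf.
have cyx : connect (adj_in G L) y x.
  apply: connect1; rewrite /adj_in /= xL inL //=; apply/existsP; exists e.
  by rewrite he setUC.
have cxw := connect_trans (sub _ _ (component_connect xK zK)) czw.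
by split=> //; [exact: inL | exact: inL | exact: connect_trans cyx cxw].
Qed.

Lemma boundary_inner_ge x z : x \in K -> z \in K ->
  lev x i -> lev z i -> shift_ge [:: x; z] 0.
Proof.
move=> xK zK lx lz.
have := component_dist_ge (component_in xK) (component_connect xK zK) lx lz.
by rewrite (_ : i + i - i - i = 0)%R //; lia.
Qed.

Lemma boundary_outer_ge e f x y z w :
  ends G e = [set x; y] -> ends G f = [set z; w] -> x \in K -> z \in K ->
  lev y (i + 1) -> lev w (i + 1) -> shift_ge [:: y; w] 0.
Proof.
move=> he hf xK zK ly lw.
have [yL wL xL cyw _] := outer_connect he hf xK zK ly lw.
have := component_dist_ge yL cyw ly lw.
by rewrite (_ : _ - _ - _ = 0)%R //; lia.
Qed.

(** Deleting two distinct boundary edges from [F] leaves a join [M] for [[:: x; y; z; w]] of size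
    [nu - 2]. Exchange it at [y] with a smallest join for [[:: r; x]], of size [nu + i]. Whichever
    of [r], [z], [w] is paired with [y], the two new joins have total size at least [2 nu + i], a
    contradiction: the excesses are bounded by [i + 1] and [-1] in the first two cases, by [0] and
    [i] in the third. *)
Lemma min_join_boundary_uniq F e f : min_join G T F ->
  e \in F :&: boundary G K -> f \in F :&: boundary G K -> e = f.
Proof.
move=> /andP[/is_join_shift hF /eqP eF] /setIP[eF' /boundary_lev[x [y [he xK yK lx ly]]]].
move=> /setIP[fF /boundary_lev[z [w [hf zK wK lz lw]]]].
apply/eqP; apply: contraT => nef.
have [yL wL xL cyw cxw] := outer_connect he hf xK zK ly lw.
have [M hM eM] : exists2 M, join_shift [:: x; y; z; w] M &
    (#|M|%:Z = (nu G T)%:Z - 2)%R.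
  exists (sdiff F [set e; f]); last first.
    by rewrite card_sdiff_weight big_setU1 ?inE // big_set1 /weight eF' fF eF.
  move=> v; have -> : sdiff F [set e; f] = sdiff F (sdiff [set e] [set f]).
    apply/setP=> g; rewrite !in_sdiff !inE.
    by case: (eqVneq g e) => [->|] //=; rewrite (negPf nef).
  by rewrite !odd_at_sdiff !odd_at1 hF (in_ends_xor _ he) (in_ends_xor _ hf); xor.
have [[M2 hM2 eM2] gx] := lx.
have hx v : parity [:: x; y; z; w] v (+) parity [:: r; x] v =
            parity [:: y; r; z; w] v by xor.
have cxz := component_connect xK zK; have xi := component_in xK.
have [k [N1 [N2 [kin hN1 hN2 eN]]]] := exchange hM hM2 hx.
move: kin; rewrite !inE => /or3P[] /eqP ek; subst k.
- have [_ lw'] := lw.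
  have /(component_shift_ge xi cxz lx lz lw') : join_shift [:: r; w; x; z] N1.
    by move=> v; rewrite hN1; xor.
  have /(shift_ge_edge he shift_ge0) : join_shift [:: x; y] N2.
    by move=> v; rewrite hN2; xor.
  by move: eM eM2 eN; clear; lia.
- have /(component_dist_ge xL cxw lx lw) : join_shift [:: x; w] N1.
    by move=> v; rewrite hN1; xor.
  have [_ ly'] := ly.
  have /(component_shift_ge xi cxz lx lz ly') : join_shift [:: r; y; x; z] N2.
    by move=> v; rewrite hN2; xor.
  by move: eM eM2 eN; clear; lia.
- have /(component_dist_ge xi cxz lx lz) : join_shift [:: x; z] N1.
    by move=> v; rewrite hN1; xor.
  have /(component_shift_ge yL cyw ly lw gx) : join_shift [:: r; x; y; w] N2.
    by move=> v; rewrite hN2; xor.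
  by move: eM eM2 eN; clear; lia.
Qed.

Lemma path_enters x y p : path_between G x y p -> x \notin K -> y \in K ->
  exists u e v p1 p2, [/\ p = p1 ++ (e, v) :: p2, path_between G x u p1,
    path_between G v y p2 & u \notin K /\ v \in K /\ ends G e = [set u; v]].
Proof.
rewrite /path_between; elim: p x => [|[e v] p IH] x /and3P[] /=.
  by move=> _ _ /eqP <- /negPf ->.
move=> /andP[/eqP he hw] /andP[hx hu] hl xK yK.
have hp : [&& walk G v p, uniq (v :: unzip2 p) & last v (unzip2 p) == y].
  exact/and3P.
case vK: (v \in K).
  by exists x, e, v, [::], p; split=> //; rewrite /= eqxx.
have [u [f [t [p1 [p2 [ep /and3P[w1 u1 l1] h2 h3]]]]]] := IH v hp (negbT vK) yK.
exists u, f, t, ((e, v) :: p1), p2; split=> //; first by rewrite ep.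
rewrite /= he eqxx w1 l1 !andbT /=; apply/andP; split=> //.
apply: contra hx; rewrite ep /unzip2 map_cat !inE mem_cat.
by case/orP => ->; rewrite ?orbT.
Qed.

(** Take a path of weight [a] from [r] to a vertex of [K] of level [a]. Up to its entry edge it
    weighs at least [i + 1], after it at least [a - i], so the entry edge has negative weight and
    lies in [F]. *)
Lemma min_join_boundary_exists F : r \notin K -> min_join G T F ->
  exists e, e \in F :&: boundary G K.
Proof.
move=> rK mF.
have [x xK] : exists x, x \in K.
  move: hK => /imsetP[x xL ->]; exists x; by rewrite inE xL connect0.
have := component_in xK; rewrite inE => /asboolP[a la _].
have [p hp ep] := lev_path mF la.
have [u [e [v [p1 [p2 [epp hp1 hp2 [uK [vK he]]]]]]]] := path_enters hp rK xK.
have eK : e \in boundary G K by rewrite (in_boundary _ he) vK (negPf uK).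
exists e; rewrite inE eK andbT.
have [v' [u' [he' v'K u'K lv lu]]] := boundary_lev eK.
have evv : v' = v.
  have : v \in ends G e by rewrite he !inE eqxx orbT.
  by rewrite he' !inE => /orP[/eqP //|/eqP evu]; rewrite -evu vK in u'K.
have euu : u' = u.
  have : u \in ends G e by rewrite he !inE eqxx.
  by rewrite he' !inE => /orP[/eqP euv|/eqP //]; rewrite euv v'K in uK.
subst v' u'.
have [h1 e1] := min_join_path mF hp1; have [h2 e2] := min_join_path mF hp2.
have [_ /(_ _ h1) b1] := lu.
have := component_dist_ge (component_in vK) (component_connect vK xK) lv la h2.
move: ep; rewrite epp /path_weight big_cat big_cons -!/(path_weight _ _) /= /weight.
by case: ifP => // _; move: b1 e1 e2; clear; lia.
Qed.
End Component.
End Levels.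

(** * Factor-components and the relation [sim] *)

Section Classes.
Variables (V E : finType) (G : graph V E) (T : {set V}).
Implicit Types (x y u v : V) (X K : {set V}) (M N : {set E}).

Lemma allowed_edge_rel F e x y : min_join G T F -> e \in F ->
  ends G e = [set x; y] -> edge_rel G (allowed G T) x y.
Proof.
move=> mF eF he; apply/exists_inP; exists e; last by rewrite he.
by rewrite inE; apply/existsP; exists F; rewrite mF.
Qed.

Lemma factor_connected_sym : symmetric (factor_connected G T).
Proof. by apply: sym_connect_sym; apply: edge_rel_sym. Qed.

Definition factor_class x : {set V} := [set y | factor_connected G T x y].

Lemma factor_class_component x : factor_component G T (factor_class x).
Proof.
apply/maxsetP; split=> [|Y /forall_inP hY sY].
  apply/forall_inP => y; rewrite inE factor_connected_sym => xy.
  by apply/forall_inP => z; rewrite inE; apply: connect_trans xy.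
apply/eqP; rewrite eqEsubset sY andbT; apply/subsetP=> y yY; rewrite inE.
have xY : x \in Y by apply: (subsetP sY); rewrite inE; apply: connect0.
by move: y yY; apply/forall_inP/hY.
Qed.

(** Let [C] be the factor-component of [x1]. No edge of a minimum join crosses [C], so such a join
    meets the boundary of [C :&: K] only in its edge across [K], and only if the inner end of that
    edge lies in [C]. By [cut_parity] this is decided by the parity of [T] on [C :&: K], the same
    for both joins. *)
Lemma factor_connected_boundary K F1 F2 e1 e2 x1 y1 x2 y2 :
  min_join G T F1 -> min_join G T F2 ->
  F1 :&: boundary G K = [set e1] -> F2 :&: boundary G K = [set e2] ->
  ends G e1 = [set x1; y1] -> x1 \in K -> y1 \notin K ->
  ends G e2 = [set x2; y2] -> x2 \in K -> y2 \notin K ->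
  factor_connected G T x1 x2.
Proof.
move=> m1 m2 b1 b2 he1 x1K y1K he2 x2K y2K.
pose C := factor_class x1; pose X := C :&: K.
have cut F e x y : min_join G T F -> F :&: boundary G K = [set e] ->
    ends G e = [set x; y] -> x \in K -> y \notin K ->
    F :&: boundary G X = if x \in C then [set e] else set0.
  move=> mF bF he xK yK; apply/setP=> f.
  case: (eqVneq f e) => [->|nfe].
    have /setIP[eF _] : e \in F :&: boundary G K by rewrite bF inE.
    rewrite in_setI eF (in_boundary _ he) !in_setI xK (negPf yK) andbT andbF addbF.
    by case: (x \in C); rewrite !inE ?eqxx.
  transitivity false; last by case: ifP; rewrite !inE ?(negPf nfe).
  apply/negP => /setIP[fF fX].
  have /eqP/cards2P[a [b [_ hf]]] := card_ends G f.
  have ab := connect1 (allowed_edge_rel mF fF hf).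
  have eC : (b \in C) = (a \in C).
    rewrite !inE; apply/idP/idP => h; last exact: connect_trans h ab.
    apply: connect_trans h _; rewrite -/(factor_connected G T b a).
    by rewrite factor_connected_sym.
  have : f \in F :&: boundary G K.
    move: fX; rewrite in_setI fF !(in_boundary _ hf) !in_setI eC.
    by case: (a \in C).
  by rewrite bF inE (negPf nfe).
have odd1 F e x y : min_join G T F -> F :&: boundary G K = [set e] ->
    ends G e = [set x; y] -> x \in K -> y \notin K ->
    (x \in C) = \big[addb/false]_(z in X) (z \in T).
  move=> mF bF he xK yK; have := cut_parity G F X.
  rewrite (cut _ _ _ _ mF bF he xK yK) => h.
  have /andP[/is_join_shift hF _] := mF.
  transitivity (\big[addb/false]_(z in X) odd_at G F z).
    by rewrite -h; case: (x \in C); rewrite ?cards1 ?cards0.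
  by apply: eq_bigr => z _; rewrite hF addbF.
have : x2 \in C.
  rewrite (odd1 _ _ _ _ m2 b2 he2 x2K y2K) -(odd1 _ _ _ _ m1 b1 he1 x1K y1K).
  by rewrite inE; apply: connect0.
by rewrite inE.
Qed.

(* Swap the two joins inside [K]: the swapped part is a path system whose only
   odd vertices are the inner ends of the two boundary edges. *)
Lemma nu_shift_boundary K F1 F2 e1 e2 x1 y1 x2 y2 :
  min_join G T F1 -> min_join G T F2 ->
  F1 :&: boundary G K = [set e1] -> F2 :&: boundary G K = [set e2] ->
  ends G e1 = [set x1; y1] -> x1 \in K -> y1 \notin K ->
  ends G e2 = [set x2; y2] -> x2 \in K -> y2 \notin K ->
  shift_ge G T [:: x1; x2] 0 -> x1 != x2 ->
  nu G T = nu G (symdiff T [set x1; x2]).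
Proof.
move=> /andP[/is_join_shift h1 /eqP c1] /andP[/is_join_shift h2 /eqP c2].
move=> b1 b2 he1 x1K y1K he2 x2K y2K hge nx.
pose D := sdiff F1 F2; pose P := [set e in D | ends G e \subset K].
have oP x : odd_at G P x = parity [:: x1; x2] x.
  case xK: (x \in K); last first.
    rewrite odd_at_big big1 => [|e _]; last first.
      rewrite inE; apply/negbTE/negP => /andP[/andP[_ /subsetP sK] xe].
      by rewrite sK in xK.
    have -> : parity [:: x1; x2] x = false => //=.
    by do 2![case: eqP => [ex|_]; first by rewrite ex ?x1K ?x2K in xK].
  (* At a vertex of [K], the edges of [D] missing from [P] are boundary edges, and on the boundary
     [D] is {e1} Δ {e2}. *)
  have -> : odd_at G P x = odd_at G (sdiff D (sdiff [set e1] [set e2])) x.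
    rewrite !odd_at_big; apply: eq_bigr => e _; rewrite in_sdiff inE.
    case xe: (x \in ends G e); last by rewrite !andbF.
    have /eqP/cards2P[a [b [_ he]]] := card_ends G e.
    have := in_boundary K he; rewrite !andbT.
    have -> : (e \in sdiff [set e1] [set e2]) = (e \in D) && (e \in boundary G K).
      by rewrite !in_sdiff -b1 -b2 !inE; do ?[case: (e \in _)]; case: (_ == 1).
    move=> ->; rewrite he subUset !sub1set; move: xe; rewrite he.
    by case/set2P => <-; rewrite xK; case: (_ \in K); case: (e \in D).
  rewrite !odd_at_sdiff !odd_at1 (in_ends_xor _ he1) (in_ends_xor _ he2) h1 h2.
  have -> : x == y1 = false by apply/eqP => ex; rewrite -ex xK in y1K.
  have -> : x == y2 = false by apply/eqP => ex; rewrite -ex xK in y2K.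
  by rewrite /= addbb !addbF.
have j1 : join_shift G T [:: x1; x2] (sdiff F1 P).
  by move=> x; rewrite odd_at_sdiff h1 oP addbF.
have j2 : join_shift G T [:: x1; x2] (sdiff F2 P).
  by move=> x; rewrite odd_at_sdiff h2 oP addbF.
have isj M : is_join G (symdiff T [set x1; x2]) M <-> join_shift G T [:: x1; x2] M.
  have tx x : (x \in symdiff T [set x1; x2]) = (x \in T) (+) parity [:: x1; x2] x.
    rewrite !inE /= addbF; case: (eqVneq x x1) => [->|_].
      by rewrite (negPf nx); case: (_ \in T).
    by case: (_ \in T); case: (_ == _).
  split=> [/forallP h x|h]; first by rewrite -tx; apply/eqP/h.
  by apply/forallP => x; rewrite tx; apply/eqP/h.
(* Both swapped joins have at least [nu] edges and together [2 nu], so each has exactly [nu]. *)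
have g1 := hge _ j1; have g2 := hge _ j2.
have sP : P \subset sdiff F1 F2 by apply/subsetP=> e; rewrite inE => /andP[].
have cs := card_sdiff_exchange sP.
have cP : #|sdiff F1 P| = nu G T by lia.
rewrite -cP; symmetry; apply: nu_eq; first exact/isj.
by move=> N /isj/hge; lia.
Qed.
End Classes.

(** * Comparison of all allowed boundary edges with the one in [F] *)

Theorem theorem7p2 (V E : finType) (G : graph V E) (T : {set V})
    (hgraft : graft G T) (hbip : bipartite G)
    (F : {set E}) (hF : min_join G T F)
    (r : V) (K : {set V}) (hK : decapital_distance_component G F r K) :
  let U := \bigcup_(e in allowed G T :&: boundary G K) ends G e in
  exists (C S1 S2 : {set V}),
    [/\ factor_component G T C,
        S1 \in classes_in G T C /\ S2 \in classes_in G T C,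
        S1 <> S2,
        U :&: K \subset S1 &
        U :\: K \subset S2].
Proof.
move=> U; case: hK => -[i _]; rewrite (sublevelE _ _ hF) => hKc rK.
have cutF F' : min_join G T F' -> exists e, F' :&: boundary G K = [set e].
  move=> mF'; have [e eF'] := min_join_boundary_exists hbip hKc rK mF'.
  exists e; apply/setP=> f; rewrite in_set1.
  apply/idP/eqP => [fF'|-> //].
  exact: (min_join_boundary_uniq hbip hKc mF' fF' eF').
have [e0 bF] := cutF _ hF.
have /setIP[e0F e0K] : e0 \in F :&: boundary G K by rewrite bF inE.
have [u0 [v0 [he0 u0K v0K lu0 lv0]]] := boundary_lev hbip hKc e0K.
(* The outer ends are treated by the same lemmas, applied to the complement of [K]. *)
have bC X : boundary G (~: X) = boundary G X.
  apply/setP=> e; have /eqP/cards2P[a [b [_ he]]] := card_ends G e.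
  by rewrite !(in_boundary _ he) !inE; case: (a \in X); case: (b \in X).
have main e : e \in allowed G T :&: boundary G K -> exists u v,
    [/\ ends G e = [set u; v], u \in K, v \notin K, sim G T u0 u & sim G T v0 v].
  case/setIP; rewrite inE => /existsP[F2 /andP[mF2 eF2]] eK.
  have [e2 bF2] := cutF _ mF2.
  have ee2 : e = e2.
    by apply/set1P; rewrite -bF2 inE eF2.
  subst e2.
  have [u [v [he uK vK lu lv]]] := boundary_lev hbip hKc eK.
  exists u, v.
  have fu := factor_connected_boundary hF mF2 bF bF2 he0 u0K v0K he uK vK.
  have bF' := bF; have bF2' := bF2; rewrite -bC in bF'; rewrite -bC in bF2'.
  have he0' := he0; have he' := he; rewrite setUC in he0'; rewrite setUC in he'.
  have v0K' : v0 \in ~: K by rewrite inE.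
  have vK' : v \in ~: K by rewrite inE.
  have u0K' : u0 \notin ~: K by rewrite inE u0K.
  have uK' : u \notin ~: K by rewrite inE uK.
  have fv := factor_connected_boundary hF mF2 bF' bF2' he0' v0K' u0K' he' vK' uK'.
  have inC x y : factor_connected G T x y ->
      [exists C, [&& factor_component G T C, x \in C & y \in C]].
    move=> xy; apply/existsP; exists (factor_class G T x).
    by rewrite factor_class_component !inE xy /factor_connected connect0.
  have gu := boundary_inner_ge hbip hKc u0K uK lu0 lu.
  have gv := boundary_outer_ge hbip hKc he0 he u0K uK lv0 lv.
  split=> //; rewrite /sim /= inC //=; case: eqP => //= /eqP ne; apply/eqP.
    exact: (nu_shift_boundary hF mF2 bF bF2 he0 u0K v0K he uK vK gu ne).
  exact: (nu_shift_boundary hF mF2 bF' bF2' he0' v0K' u0K' he' vK' uK' gv ne).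
pose C := factor_class G T u0.
have simC x y : x \in C -> sim G T x y -> y \in C.
  rewrite !inE => u0x /orP[/eqP <- //|/andP[/existsP[D /and3P[cD xD yD]] _]].
  apply: connect_trans u0x _.
  by have /maxsetP[/forall_inP/(_ _ xD)/forall_inP/(_ _ yD)] := cD.
have u0C : u0 \in C by rewrite inE; apply: connect0.
(* The edge [e0] is itself allowed, so both classes lie in the same factor-component. *)
have u0v0 := allowed_edge_rel hF e0F he0.
have v0C : v0 \in C by rewrite inE; apply: connect1.
have clC x : x \in C -> [set y in [set: V] | sim G T x y] \in classes_in G T C.
  move=> xC; rewrite inE; apply/andP; split.
    by apply: imset_f; rewrite inE.
  by apply/subsetP=> y; rewrite inE => /andP[_]; apply: simC.
exists C, [set y in [set: V] | sim G T u0 y], [set y in [set: V] | sim G T v0 y].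
split.
- exact: factor_class_component.
- by split; apply: clC.
(* Equal classes would give [u0] and [v0] the same [nu] after the shift, yet [F] without [e0] is a
   join for T Δ {u0, v0} with one edge less. *)
- move=> eS; have nuv := ends_neq he0.
  have : v0 \in [set y in [set: V] | sim G T v0 y] by rewrite !inE /sim /= eqxx.
  rewrite -eS !inE /sim /= (negPf nuv) => /andP[_ /eqP enu].
  have /andP[/is_join_shift jF /eqP cF] := hF.
  have : is_join G (symdiff T [set u0; v0]) (sdiff F [set e0]).
    apply/forallP=> x; apply/eqP; rewrite -/(odd_at G (sdiff F [set e0]) x).
    rewrite odd_at_sdiff odd_at1 jF (in_ends_xor _ he0) !inE /= addbF.
    case: (eqVneq x u0) => [->|_]; first by rewrite (negPf nuv); case: (_ \in T).
    by case: (_ \in T); case: (_ == _).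
  move/nu_le; rewrite -enu.
  have := card_sdiff_weight F [set e0]; rewrite big_set1 /weight e0F cF; lia.
- apply/subsetP=> x /setIP[/bigcupP[e /main[u [v [he uK vK su sv]]]]].
  rewrite he !inE => /orP[] /eqP -> // vK'.
  by rewrite vK' in vK.
- apply/subsetP=> x /setDP[/bigcupP[e /main[u [v [he uK vK su sv]]]]].
  rewrite he !inE => /orP[] /eqP -> //.
  by rewrite uK.
Qed.
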